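(* Let $X$ and $Y$ be higher-dimensional automata. Then $X$ and $Y$ are homotopy bisimilar if and only if they are bisimilar.
   Context: A precubical set is a graded set $X=\{X_n\}_{n\in\mathbb{N}}$ with face maps $\delta_k^\nu: X_n\to X_{n-1}$ ($k\in\{1,\dots,n\}$, $\nu\in\{0,1\}$) satisfying $\delta_k^\nu\delta_\ell^\mu=\delta_{\ell-1}^\mu\delta_k^\nu$ for $k<\ell$; morphisms are graded maps commuting with face maps. The category HDA of higher-dimensional automata is the comma category $*\downarrow$ (precubical sets), i.e. pointed precubical sets $i:*\to X$ with point-preserving morphisms. A cube path in $X$ is a sequence $(x_1,\dots,x_m)$ with, for each $j$, $x_j=\delta_k^0x_{j+1}$ or $x_{j+1}=\delta_k^1x_j$ for some $k$; it is pointed if $x_1=i$. A precubical path object is a precubical set generated (with unique increasing index sequences of face maps) by a cube path of pairwise distinct elements; the category HDP of higher-dimensional paths is the subcategory of HDA whose objects are pointed precubical path objects and whose morphisms are generated by isomorphisms and pointed cube path extensions (morphisms $P\to Q$ with $P$ represented by $(x_1,\dots,x_m)$, $Q$ by $(x_1,\dots,x_m,\dots,x_p)$, acting as inclusion). A morphism $f:X\to Y$ in HDA is open if it has the right lifting property with respect to all morphisms of HDP; $X$ and $Y$ are bisimilar if there is a span of open maps $X\leftarrow Z\to Y$ in HDA. Homotopy of cube paths is the reflexive transitive closure of adjacency (cube paths with the same endpoints differing in exactly one position by a square-swap of face maps, as in Mazurkiewicz-trace equivalence). The unfolding $\tilde X$ of $X$ has as $n$-cubes the homotopy classes $[x_1,\dots,x_m]$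 of pointed cube paths ending in an $n$-cube, point $[i]$, $\tilde\delta_k^1[x_1,\dots,x_m]=[x_1,\dots,x_m,\delta_k^1x_m]$, $\tilde\delta_k^0[x_1,\dots,x_m]=$ the class of cube paths $\sigma$ ending in $\delta_k^0x_m$ with $\sigma*x_m\sim(x_1,\dots,x_m)$, and projection $\pi_X[x_1,\dots,x_m]=x_m$. A higher-dimensional tree is an HDA in which every cube has exactly one homotopy class of pointed cube paths to it; HDT is the full subcategory of these. The category HDAh (HDA up to homotopy) has HDA as objects and as morphisms $X\to Y$ the pointed precubical morphisms $\tilde X\to\tilde Y$ of unfoldings; HDTh is its full subcategory on trees, and the projections give an isomorphism HDTh $\cong$ HDT, under which HDP corresponds to a subcategory HDPh. A morphism in HDAh is open if it has the right lifting property with respect to all morphisms of HDPh; $X$ and $Y$ are homotopy bisimilar if there is a span of open maps $X\leftarrow Z\to Y$ in HDAh.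
   Formalization: For homotopy and unfoldings, cube paths record the face index of each step (else lower faces of the unfolding can be ill-defined); path objects are freely generated: a common face of two members of the cube path is a face of all members in between (else they need not be trees). *)

(* Defs.v *)
From Stdlib Require Import Relation_Operators.
From mathcomp Require Import all_boot boolp zify.

Set Implicit Arguments.
Unset Strict Implicit.
Unset Printing Implicit Defensive.

(* Face indices are 0-based: the face maps out of (n+1)-cubes are indexed by
   'I_n.+1, and nu : bool is false for lower (0) and true for upper (1) faces.
   With l.+1 in the role of the larger index, the axiom reads
   d_k^nu d_(l+1)^mu = d_l^mu d_k^nu for k < l+1. *)
Record precubical := Precubical {
  cell :> nat -> Type;
  face : forall n, 'I_n.+1 -> bool -> cell n.+1 -> cell n;
  face_face : forall n (k l : 'I_n.+1) (nu mu : bool) (x : cell n.+2),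
    k <= l ->
    face k nu (face (lift ord0 l) mu x) =
    face l mu (face (widen_ord (leqnSn _) k) nu x) }.

Definition cube (X : precubical) : Type := {n : nat & X n}.

(* is_face k nu y x means y = d_k^nu x *)
Inductive is_face (X : precubical) : nat -> bool -> cube X -> cube X -> Prop :=
  IsFace n (k : 'I_n.+1) nu (x : X n.+1) :
    is_face k nu (existT X n (face k nu x)) (existT X n.+1 x).

(* A map from the one-point precubical set to X is an element of X_0. *)
Record hda := Hda { hda_pcub :> precubical; init : hda_pcub 0 }.

Definition pt (X : hda) : cube X := existT X 0 (init X).

Record hda_hom (X Y : hda) := HdaHom {
  hom_fun :> forall n, X n -> Y n;
  hom_face : forall n (k : 'I_n.+1) nu (x : X n.+1),
    hom_fun (face k nu x) = face k nu (hom_fun x);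
  hom_init : hom_fun (init X) = init Y }.

Definition hom_eq (X Y : hda) (f g : hda_hom X Y) : Prop :=
  forall n (x : X n), f n x = g n x.

Definition hom_id (X : hda) : hda_hom X X :=
  @HdaHom X X (fun _ x => x) (fun _ _ _ _ => erefl) erefl.

Lemma comp_face (X Y Z : hda) (g : hda_hom Y Z) (f : hda_hom X Y) n
    (k : 'I_n.+1) nu (x : X n.+1) :
  g n (f n (face k nu x)) = face k nu (g n.+1 (f n.+1 x)).
Proof. by rewrite !hom_face. Qed.

Lemma comp_init (X Y Z : hda) (g : hda_hom Y Z) (f : hda_hom X Y) :
  g 0 (f 0 (init X)) = init Z.
Proof. by rewrite !hom_init. Qed.

Definition hom_comp (X Y Z : hda) (g : hda_hom Y Z) (f : hda_hom X Y) :
    hda_hom X Z :=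
  @HdaHom X Z (fun n x => g n (f n x)) (comp_face g f) (comp_init g f).

Definition hom_iso (X Y : hda) (f : hda_hom X Y) : Prop :=
  exists g : hda_hom Y X,
    hom_eq (hom_comp g f) (hom_id X) /\ hom_eq (hom_comp f g) (hom_id Y).

Definition hom_cube (X Y : hda) (f : hda_hom X Y) (x : cube X) : cube Y :=
  existT Y (tag x) (f (tag x) (tagged x)).

Definition has_rlp (X Y P Q : hda) (f : hda_hom X Y) (g : hda_hom P Q) : Prop :=
  forall (p : hda_hom P X) (q : hda_hom Q Y),
    hom_eq (hom_comp f p) (hom_comp q g) ->
    exists r : hda_hom Q X, hom_eq (hom_comp r g) p /\ hom_eq (hom_comp f r) q.

Definition cube_path (X : precubical) (s : seq (cube X)) : Prop :=
  s <> [::] /\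
  forall j x y, onth s j = Some x -> onth s j.+1 = Some y ->
    exists k, is_face k false x y \/ is_face k true y x.

(* iter_face [:: (k1, nu1); ...; (kp, nup)] y x means
   y = d_k1^nu1 ... d_kp^nup x with k1 < ... < kp. *)
Fixpoint iter_face_rec (X : precubical) (s : seq (nat * bool))
    (y x : cube X) : Prop :=
  match s with
  | [::] => y = x
  | (k, nu) :: s' => exists2 z, is_face k nu y z & iter_face_rec s' z x
  end.

Definition iter_face (X : precubical) (s : seq (nat * bool))
    (y x : cube X) : Prop :=
  sorted ltn (unzip1 s) /\ iter_face_rec s y x.

(* X is generated by the cube path s. The last clause says that the cubes of
   the path are glued along consecutive members only: a common face of x_i and
   x_j is a face of every x_l in between. Without it two cells off the path
   could be identified, and X would not be a tree (nor determined by the type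
   of its cube path). *)
Definition path_representation (X : precubical) (s : seq (cube X)) : Prop :=
  [/\ cube_path s,
      forall i j x, onth s i = Some x -> onth s j = Some x -> i = j,
      forall y, exists j x t, onth s j = Some x /\ iter_face t y x,
      forall j x y t t', onth s j = Some x ->
        iter_face t y x -> iter_face t' y x -> t = t' &
      forall i l j xi xl xj y, i <= l <= j ->
        onth s i = Some xi -> onth s l = Some xl -> onth s j = Some xj ->
        (exists t, iter_face t y xi) -> (exists t, iter_face t y xj) ->
        exists t, iter_face t y xl].

Definition pointed_representation (P : hda) (s : seq (cube P)) : Prop :=
  path_representation s /\ onth s 0 = Some (pt P).

Definition hdp_object (P : hda) : Prop :=
  exists s : seq (cube P), pointed_representation s.

Definition path_extension (P Q : hda) (f : hda_hom P Q) : Prop :=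
  exists (s : seq (cube P)) (t : seq (cube Q)),
    pointed_representation s /\
    pointed_representation (map (hom_cube f) s ++ t).

Inductive hdp_hom : forall P Q : hda, hda_hom P Q -> Prop :=
| Hdp_iso P Q (f : hda_hom P Q) :
    hdp_object P -> hdp_object Q -> hom_iso f -> hdp_hom f
| Hdp_ext P Q (f : hda_hom P Q) : path_extension f -> hdp_hom f
| Hdp_comp P Q R (g : hda_hom Q R) (f : hda_hom P Q) :
    hdp_hom f -> hdp_hom g -> hdp_hom (hom_comp g f).

Definition hda_open (X Y : hda) (f : hda_hom X Y) : Prop :=
  forall (P Q : hda) (g : hda_hom P Q), hdp_hom g -> has_rlp f g.

Definition bisimilar (X Y : hda) : Prop :=
  exists (Z : hda) (f : hda_hom Z X) (g : hda_hom Z Y),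
    hda_open f /\ hda_open g.

(* For homotopy, a pointed cube path (i, x_2, ..., x_m) is stored without its
   first element i, as a sequence of entries (nu, k, x_j): nu = false means
   x_(j-1) = d_k^0 x_j and nu = true means x_j = d_k^1 x_(j-1). The index k is
   part of the path: if it were forgotten, the lower faces of the unfolding
   would not be well defined when a cube has coinciding faces, e.g. for a
   square with equal upper faces but distinct lower faces. *)
Definition entry (X : precubical) : Type := ((bool * nat) * cube X)%type.

Definition step (X : precubical) (x : cube X) (e : entry X) : Prop :=
  let: (nu, k, y) := e in
  if nu then is_face k true y x else is_face k false x y.

Fixpoint steps (X : precubical) (x : cube X) (p : seq (entry X)) : Prop :=
  if p is e :: p' then step x e /\ steps e.2 p' else True.

Definition target (X : precubical) (x : cube X) (p : seq (entry X)) : cube X :=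
  last x (map snd p).

Definition pointed_path (X : hda) (p : seq (entry X)) : Prop := steps (pt X) p.

Definition end_cube (X : hda) (p : seq (entry X)) : cube X := target (pt X) p.

(* square u s t: the two-step paths s and t starting in u bound a square. *)
Inductive square (X : precubical) (u : cube X) :
    seq (entry X) -> seq (entry X) -> Prop :=
| Square00 k l x y z :
    k < l -> is_face k false u x -> is_face l false x z ->
    is_face l.-1 false u y -> is_face k false y z ->
    square u [:: (false, k, x); (false, l, z)]
             [:: (false, l.-1, y); (false, k, z)]
| Square11 k l x y w :
    k < l -> is_face l true x u -> is_face k true w x ->
    is_face k true y u -> is_face l.-1 true w y ->
    square u [:: (true, l, x); (true, k, w)]
             [:: (true, k, y); (true, l.-1, w)]
| Square01 k l x y w :
    k < l -> is_face k false u y -> is_face l true w y ->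
    is_face l.-1 true x u -> is_face k false x w ->
    square u [:: (false, k, y); (true, l, w)]
             [:: (true, l.-1, x); (false, k, w)]
| Square10 k l x y w :
    k < l -> is_face l false u y -> is_face k true w y ->
    is_face k true x u -> is_face l.-1 false x w ->
    square u [:: (false, l, y); (true, k, w)]
             [:: (true, k, x); (false, l.-1, w)].

Definition adjacent (X : hda) (p q : seq (entry X)) : Prop :=
  exists p1 p2 s t,
    [/\ p = p1 ++ s ++ p2, q = p1 ++ t ++ p2 &
        square (end_cube p1) s t \/ square (end_cube p1) t s].

Definition homotopic (X : hda) : seq (entry X) -> seq (entry X) -> Prop :=
  clos_refl_trans _ (@adjacent X).

Definition is_class (X : hda) (x : cube X) (C : seq (entry X) -> Prop) : Prop :=
  exists2 p, pointed_path p /\ end_cube p = x & C = homotopic p.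

Definition unf_cell (X : hda) (n : nat) : Type :=
  {C : seq (entry X) -> Prop | exists x : X n, is_class (existT X n x) C}.

Definition unf_face_set (X : hda) (k : nat) (nu : bool)
    (C : seq (entry X) -> Prop) : seq (entry X) -> Prop :=
  if nu then
    fun q => exists p x, [/\ C p, is_face k true x (end_cube p) &
                             homotopic (rcons p (true, k, x)) q]
  else
    fun p => exists x, C (rcons p (false, k, x)).

Definition dface (X : precubical) (k : nat) (nu : bool) (x : cube X) : cube X :=
  match x with
  | existT 0 _ => x
  | existT n.+1 y => if insub k is Some k' then existT X n (face k' nu y) else x
  end.

Lemma is_faceP (X : precubical) k nu (y x : cube X) :
  is_face k nu y x <-> k < tag x /\ y = dface k nu x.
Proof.
split=> [[n {}k {}nu {}x] /=|]; first by rewrite ltn_ord valK.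
case: x => [[|n] x] [//= lt_k ->]; rewrite (insubT (fun k => k < n.+1) lt_k).
exact: (@IsFace X n (Ordinal lt_k)).
Qed.

Lemma is_face_dface (X : precubical) k nu (x : cube X) :
  k < tag x -> is_face k nu (dface k nu x) x.
Proof. by move=> h; apply/is_faceP. Qed.

Lemma tag_dface (X : precubical) k nu (x : cube X) :
  k < tag x -> tag (dface k nu x) = (tag x).-1.
Proof.
by case: x => [[|n] x] //= lt_k; rewrite (insubT (fun k => k < n.+1) lt_k).
Qed.

Lemma dface_dface (X : precubical) k l nu mu (x : cube X) :
  k < l -> l < tag x ->
  dface k nu (dface l mu x) = dface l.-1 mu (dface k nu x).
Proof.
case: x => [[|[|n]] x] //=; first by lia.
case: l => // l lt_kl lt_l; rewrite ltnS in lt_l.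
have lt_k : k < n.+1 by lia.
rewrite (insubT (fun k => k < n.+2) (lt_l : l.+1 < n.+2)).
rewrite (insubT (fun k => k < n.+2) (ltnW lt_k : k < n.+2)) /=.
rewrite (insubT (fun k => k < n.+1) lt_k).
rewrite (insubT (fun k => k < n.+1) lt_l) /=.
have := @face_face X n (Ordinal lt_k) (Ordinal lt_l) nu mu x lt_kl.
have -> : lift ord0 (Ordinal lt_l) = Ordinal (lt_l : l.+1 < n.+2) by apply/val_inj.
have -> : widen_ord (leqnSn n.+1) (Ordinal lt_k) = Ordinal (ltnW lt_k : k < n.+2).
  exact/val_inj.
by move=> /= ->.
Qed.

Lemma dfaceC (X : precubical) k l nu mu (x : cube X) :
  k != l -> k < tag x -> l < tag x ->
  dface (unbump l k) nu (dface l mu x) = dface (unbump k l) mu (dface k nu x).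
Proof.
move=> ne hk hl; case: (ltngtP k l) ne => // lt _.
- have -> : unbump l k = k by rewrite /unbump; lia.
  have -> : unbump k l = l.-1 by rewrite /unbump; lia.
  exact: dface_dface.
- have -> : unbump k l = l by rewrite /unbump; lia.
  have -> : unbump l k = k.-1 by rewrite /unbump; lia.
  by rewrite -dface_dface.
Qed.

Lemma steps_cat (X : precubical) (x : cube X) p q :
  steps x (p ++ q) <-> steps x p /\ steps (target x p) q.
Proof.
elim: p x => [|e p IH] x /=; first by split=> // -[].
split; first by case=> ? /IH [].
by case=> -[? ?] ?; split=> //; apply/IH.
Qed.

Lemma target_cat (X : precubical) (x : cube X) p q :
  target x (p ++ q) = target (target x p) q.
Proof. by rewrite /target map_cat last_cat. Qed.

Lemma pointed_path_rcons (X : hda) (p : seq (entry X)) e :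
  pointed_path (rcons p e) <-> pointed_path p /\ step (end_cube p) e.
Proof.
rewrite -cats1; split; first by case/steps_cat => ? /= [].
by case=> ? ?; apply/steps_cat; split.
Qed.

Lemma end_cube_rcons (X : hda) (p : seq (entry X)) e : end_cube (rcons p e) = e.2.
Proof. by rewrite -cats1 /end_cube target_cat. Qed.

Lemma square_steps (X : precubical) (u : cube X) s t : square u s t ->
  [/\ steps u s, steps u t & target u s = target u t].
Proof. by case=> *; split=> //=; split. Qed.

Lemma adjacent_sym (X : hda) (p q : seq (entry X)) : adjacent p q -> adjacent q p.
Proof.
by case=> p1 [p2 [s [t [-> -> h]]]]; exists p1, p2, t, s; split=> //; case: h; auto.
Qed.

Lemma adjacent_path (X : hda) (p q : seq (entry X)) : adjacent p q ->
  (pointed_path p -> pointed_path q) /\ end_cube p = end_cube q.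
Proof.
case=> p1 [p2 [s [t [-> -> h]]]].
have [hs ht est] : [/\ steps (end_cube p1) s, steps (end_cube p1) t &
    target (end_cube p1) s = target (end_cube p1) t].
  by case: h => /square_steps [].
split; last by rewrite /end_cube !target_cat -/(end_cube p1) est.
move=> /steps_cat [h1 /steps_cat [_ h2]].
by apply/steps_cat; split=> //; apply/steps_cat; split=> //; rewrite -est.
Qed.

Lemma homotopic_refl (X : hda) (p : seq (entry X)) : homotopic p p.
Proof. exact: rt_refl. Qed.

Lemma homotopic_trans (X : hda) (p q r : seq (entry X)) :
  homotopic p q -> homotopic q r -> homotopic p r.
Proof. exact: rt_trans. Qed.

Lemma homotopic_sym (X : hda) (p q : seq (entry X)) :
  homotopic p q -> homotopic q p.
Proof.
elim=> [{}p {}q /adjacent_sym|{}p|{}p {}q r _ h1 _ h2].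
- exact: rt_step.
- exact: homotopic_refl.
- exact: homotopic_trans h2 h1.
Qed.

Lemma homotopic_path (X : hda) (p q : seq (entry X)) : homotopic p q ->
  (pointed_path p -> pointed_path q) /\ end_cube p = end_cube q.
Proof.
elim=> [{}p {}q /adjacent_path|//|{}p {}q r _ [a1 b1] _ [a2 b2]]; first by [].
by split; [auto|rewrite b1].
Qed.

Lemma homotopic_cat (X : hda) (p q r : seq (entry X)) :
  homotopic p q -> homotopic (p ++ r) (q ++ r).
Proof.
elim=> [{}p {}q|{}p|{}p {}q r' _ h1 _ h2].
- case=> p1 [p2 [s [t [-> -> h]]]]; apply: rt_step.
  by exists p1, (p2 ++ r), s, t; rewrite !catA.
- exact: homotopic_refl.
- exact: homotopic_trans h1 h2.
Qed.

Lemma homotopic_rcons (X : hda) (p q : seq (entry X)) e :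
  homotopic p q -> homotopic (rcons p e) (rcons q e).
Proof. by rewrite -!cats1; exact: homotopic_cat. Qed.

Lemma homotopic_square (X : hda) (p s t : seq (entry X)) :
  square (end_cube p) s t -> homotopic (p ++ s) (p ++ t).
Proof.
by move=> h; apply: rt_step; exists p, [::], s, t; rewrite !cats0; split; auto.
Qed.

Lemma homotopicE (X : hda) (p q : seq (entry X)) :
  homotopic p q -> homotopic p = homotopic q.
Proof.
move=> h; apply/funext => r; apply/propext; split; apply: homotopic_trans => //.
exact: homotopic_sym.
Qed.

(* drop_lower k p is a path to the k-th lower face of the end of p whose
   extension by the end of p is homotopic to p. *)
Fixpoint drop_lower_rev (X : precubical) k (r : seq (entry X)) : seq (entry X) :=
  match r with
  | [::] => [::]
  | (true, l, x) :: r' =>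
      (true, unbump (bump l k) l, dface k false x) :: drop_lower_rev (bump l k) r'
  | (false, l, x) :: r' =>
      if l == k then r'
      else (false, unbump k l, dface k false x) :: drop_lower_rev (unbump l k) r'
  end.

Definition drop_lower (X : precubical) k (p : seq (entry X)) : seq (entry X) :=
  rev (drop_lower_rev k (rev p)).

Lemma drop_lower_up (X : precubical) k l (x : cube X) p :
  drop_lower k (rcons p (false, l, x)) =
  if l == k then p
  else rcons (drop_lower (unbump l k) p) (false, unbump k l, dface k false x).
Proof.
by rewrite /drop_lower rev_rcons /=; case: ifP; rewrite ?revK ?rev_cons.
Qed.

Lemma drop_lower_down (X : precubical) k l (x : cube X) p :
  drop_lower k (rcons p (true, l, x)) =
  rcons (drop_lower (bump l k) p)
        (true, unbump (bump l k) l, dface k false x).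
Proof. by rewrite /drop_lower rev_rcons /= rev_cons. Qed.

(* The four kinds of squares, up to orientation and without ordering k and l. *)
Inductive nsquare (X : precubical) (u : cube X) :
    seq (entry X) -> seq (entry X) -> Prop :=
| Nsquare_up k l z : k != l -> k < tag z -> l < tag z ->
    u = dface (unbump l k) false (dface l false z) ->
    nsquare u [:: (false, unbump l k, dface l false z); (false, l, z)]
              [:: (false, unbump k l, dface k false z); (false, k, z)]
| Nsquare_down k l w : k != l -> k < tag u -> l < tag u ->
    w = dface (unbump l k) true (dface l true u) ->
    nsquare u [:: (true, l, dface l true u); (true, unbump l k, w)]
              [:: (true, k, dface k true u); (true, unbump k l, w)]
| Nsquare_mix k l z : k != l -> k < tag z -> l < tag z ->
    u = dface k false z ->
    nsquare u [:: (false, k, z); (true, l, dface l true z)]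
              [:: (true, unbump k l, dface (unbump k l) true u);
                  (false, unbump l k, dface l true z)].

Lemma nsquare_square (X : precubical) (u : cube X) s t :
  nsquare u s t -> square u s t \/ square u t s.
Proof.
case=> [k l z ne hk hl eu|k l w ne hk hl ew|k l z ne hk hl eu].
- have tk := tag_dface false hk; have tl := tag_dface false hl.
  have eu' := eu; rewrite (dfaceC _ _ ne hk hl) in eu'.
  case: (ltngtP k l) ne => // lt _; [left|right].
  + have e1 : unbump l k = k by rewrite /unbump; lia.
    have e2 : unbump k l = l.-1 by rewrite /unbump; lia.
    rewrite ?e1 ?e2 in eu eu' *.
    by apply: Square00 => //; apply/is_faceP; split=> //; lia.
  + have e1 : unbump l k = k.-1 by rewrite /unbump; lia.
    have e2 : unbump k l = l by rewrite /unbump; lia.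
    rewrite ?e1 ?e2 in eu eu' *.
    by apply: Square00 => //; apply/is_faceP; split=> //; lia.
- have tk := tag_dface true hk; have tl := tag_dface true hl.
  have ew' := ew; rewrite (dfaceC _ _ ne hk hl) in ew'.
  case: (ltngtP k l) ne => // lt _; [left|right].
  + have e1 : unbump l k = k by rewrite /unbump; lia.
    have e2 : unbump k l = l.-1 by rewrite /unbump; lia.
    rewrite ?e1 ?e2 in ew ew' *.
    by apply: Square11 => //; apply/is_faceP; split=> //; lia.
  + have e1 : unbump l k = k.-1 by rewrite /unbump; lia.
    have e2 : unbump k l = l by rewrite /unbump; lia.
    rewrite ?e1 ?e2 in ew ew' *.
    by apply: Square11 => //; apply/is_faceP; split=> //; lia.
- have tk := tag_dface false hk; have tl := tag_dface true hl.
  left; have ew := dfaceC false true ne hk hl; rewrite -eu in ew.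
  have tu : tag u = (tag z).-1 by rewrite eu.
  case: (ltngtP k l) ne => // lt _.
  + have e1 : unbump l k = k by rewrite /unbump; lia.
    have e2 : unbump k l = l.-1 by rewrite /unbump; lia.
    rewrite ?e1 ?e2 in ew *.
    by apply: Square01 => //; apply/is_faceP; split=> //; lia.
  + have e1 : unbump l k = k.-1 by rewrite /unbump; lia.
    have e2 : unbump k l = l by rewrite /unbump; lia.
    rewrite ?e1 ?e2 in ew *.
    by apply: Square10 => //; apply/is_faceP; split=> //; lia.
Qed.

Lemma homotopic_nsquare (X : hda) (p s t : seq (entry X)) :
  nsquare (end_cube p) s t -> homotopic (p ++ s) (p ++ t).
Proof.
by case/nsquare_square => /homotopic_square //; exact: homotopic_sym.
Qed.

Lemma square_nsquare (X : precubical) (u : cube X) s t :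
  square u s t -> nsquare u s t.
Proof.
case=> k l x y z lt; rewrite !is_faceP => -[h1 e1] [h2 e2] [h3 e3] [h4 e4];
  have ek : unbump l k = k by rewrite /unbump; lia.
all: have el : unbump k l = l.-1 by rewrite /unbump; lia.
all: have ne : k != l by lia.
all: have ne' : l != k by lia.
- subst x y; have := @Nsquare_up X u k l z ne h4 h2.
  by rewrite ek el; apply.
- subst x y; have := @Nsquare_down X u k l z ne h3 h1.
  by rewrite ek el; apply.
- subst x z; have := @Nsquare_mix X u k l y ne h1 h2 e1.
  by rewrite ek el.
- subst x z; have := @Nsquare_mix X u l k y ne' h1 h2 e1.
  by rewrite ek el.
Qed.

Lemma drop_lower_homotopic (X : hda) (p : seq (entry X)) k :
  pointed_path p -> k < tag (end_cube p) ->
  homotopic (rcons (drop_lower k p) (false, k, end_cube p)) p.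
Proof.
elim/last_ind: p k => [//|p e IH] k /pointed_path_rcons [hp he].
rewrite end_cube_rcons; case: e he => [[[] l] x] /= /is_faceP [hl ex] hk.
- rewrite drop_lower_down.
  have tx : tag x = (tag (end_cube p)).-1 by rewrite ex tag_dface.
  have hk' : bump l k < tag (end_cube p) by rewrite /bump; lia.
  have ne : bump l k != l by rewrite /bump; lia.
  have h := IH _ hp hk'; apply: homotopic_trans (homotopic_rcons _ h).
  have [/(_ hp) + _] := homotopic_path (homotopic_sym h).
  case/pointed_path_rcons => _ /is_faceP [_ eu].
  have := Nsquare_mix ne hk' hl eu; rewrite bumpK -ex.
  move/homotopic_nsquare/homotopic_sym; rewrite -!cats1 -!catA /=.
  by rewrite eu -(dfaceC _ _ ne hk' hl) bumpK -ex.
- rewrite drop_lower_up; case: eqP => [->|/eqP ne]; first exact: homotopic_refl.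
  have hk' : unbump l k < tag (end_cube p).
    by rewrite ex tag_dface // /unbump; lia.
  have h := IH _ hp hk'; apply: homotopic_trans (homotopic_rcons _ h).
  have [/(_ hp) + _] := homotopic_path (homotopic_sym h).
  case/pointed_path_rcons => _ /is_faceP [_ eu].
  rewrite ex in eu; rewrite eq_sym in ne.
  move: (Nsquare_up ne hk hl eu).
  by move/homotopic_nsquare/homotopic_sym; rewrite -!cats1 -!catA /= -ex.
Qed.

Lemma drop_lower_path (X : hda) (p : seq (entry X)) k :
  pointed_path p -> k < tag (end_cube p) ->
  pointed_path (drop_lower k p) /\
  end_cube (drop_lower k p) = dface k false (end_cube p).
Proof.
move=> hp hk; have /homotopic_sym/homotopic_path [/(_ hp) + _] :=
  drop_lower_homotopic hp hk.
by case/pointed_path_rcons => ? /is_faceP [_ ->].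
Qed.

Lemma unbumpC i j k : i != j -> i != k -> j != k ->
  unbump (unbump j k) (unbump j i) = unbump (unbump k j) (unbump k i).
Proof. by rewrite /unbump; lia. Qed.

Lemma unbump_neq i j k : i != j -> i != k -> j != k -> unbump k i != unbump k j.
Proof. by rewrite /unbump; lia. Qed.

Lemma unbump_lt i k n : k != i -> i < n -> k < n -> unbump k i < n.-1.
Proof. by rewrite /unbump; lia. Qed.

Lemma drop_lower_nsquare (X : hda) (p s t : seq (entry X)) k :
  nsquare (end_cube p) s t -> pointed_path (p ++ s) ->
  k < tag (end_cube (p ++ s)) ->
  homotopic (drop_lower k (p ++ s)) (drop_lower k (p ++ t)).
Proof.
move=> sq /steps_cat [hp _]; rewrite /end_cube target_cat -/(end_cube p).
case: sq => [i j z ne hi hj eu|i j w ne hi hj ew|i j z ne hi hj eu];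
  rewrite -2!cat_rcons !cats0 -2![in X in homotopic _ X]cat_rcons cats0 /target /= => hk.
- rewrite !drop_lower_up.
  case: (j =P k) => [<-|/eqP njk].
    by rewrite (negbTE ne) eqxx; exact: homotopic_refl.
  case: (i =P k) => [<-|/eqP nik].
    by rewrite eqxx; exact: homotopic_refl.
  have nkj : k != j by rewrite eq_sym.
  have nki : k != i by rewrite eq_sym.
  have nji : j != i by rewrite eq_sym.
  rewrite (negbTE (unbump_neq nik ne nkj)) (negbTE (unbump_neq njk nji nki)).
  have tz := tag_dface false hj.
  have hK : unbump (unbump j i) (unbump j k) < tag (end_cube p).
    rewrite eu tag_dface tz; last exact: unbump_lt.
    by apply: unbump_lt; [apply: unbump_neq| apply: unbump_lt| apply: unbump_lt].
  have [_ eD] := drop_lower_path hp hK.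
  have eK : unbump (unbump j i) (unbump j k) = unbump (unbump i j) (unbump i k).
    by rewrite unbumpC.
  have eU : end_cube (drop_lower (unbump (unbump j i) (unbump j k)) p) =
      dface (unbump (unbump k j) (unbump k i)) false
        (dface (unbump k j) false (dface k false z)).
    rewrite eD eu dfaceC ?tz; try exact: unbump_lt; last exact: unbump_neq.
    by rewrite unbumpC // (dfaceC false false nkj hk hj).
  have := Nsquare_up (unbump_neq ne nik njk) _ _ eU.
  rewrite tag_dface // => /(_ (unbump_lt nki hi hk) (unbump_lt nkj hj hk)).
  move/homotopic_nsquare.
  rewrite -2!cat_rcons cats0 -2![in X in homotopic _ X -> _]cat_rcons cats0.
  rewrite -eK (unbumpC ne nik njk) (unbumpC nji njk nik).
  by rewrite -(dfaceC false false nkj hk hj) -(dfaceC false false nki hk hi).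
- subst w; rewrite !drop_lower_down.
  have tj := tag_dface true hj; have ti := tag_dface true hi.
  rewrite tag_dface tj in hk; last by apply: unbump_lt; rewrite // eq_sym.
  set K := bump j (bump (unbump j i) k).
  have eK : bump i (bump (unbump i j) k) = K by rewrite /K /bump /unbump; lia.
  rewrite eK.
  have nKj : K != j by rewrite /K /bump; lia.
  have nKi : K != i by rewrite -eK /bump; lia.
  have ek1 : bump (unbump j i) k = unbump j K by rewrite /K bumpK.
  have ek2 : bump (unbump i j) k = unbump i K by rewrite -eK bumpK.
  have ekk : k = unbump (unbump j i) (unbump j K) by rewrite -ek1 bumpK.
  have hK : K < tag (end_cube p) by rewrite /K /bump; lia.
  have njK : j != K by rewrite eq_sym.
  have niK : i != K by rewrite eq_sym.
  have nji : j != i by rewrite eq_sym.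
  rewrite ek1 ek2 -/K.
  have [_ eD] := drop_lower_path hp hK.
  have := @Nsquare_down X (end_cube (drop_lower K p)) (unbump K i) (unbump K j)
    _ (unbump_neq ne niK njK) _ _ erefl.
  rewrite eD tag_dface // => /(_ (unbump_lt nKi hi hK) (unbump_lt nKj hj hK)).
  rewrite -eD => /homotopic_nsquare.
  rewrite -2!cat_rcons cats0 -2![in X in homotopic _ X -> _]cat_rcons cats0 eD.
  rewrite -!(dfaceC false true nKj hK hj) -!(dfaceC false true nKi hK hi).
  rewrite -(unbumpC ne niK njK) -(unbumpC nji njK niK).
  rewrite [in X in X -> _](dfaceC true false) ?tj; try exact: unbump_lt; last exact: unbump_neq.
  by rewrite -ekk.
- rewrite drop_lower_down drop_lower_up [in X in homotopic _ X]drop_lower_up.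
  rewrite drop_lower_down tag_dface // in hk *.
  have tj := tag_dface true hj; have ti := tag_dface false hi.
  have nji : j != i by rewrite eq_sym.
  set K := bump j k.
  have nKj : K != j by rewrite /K /bump; lia.
  have hK : K < tag z by rewrite /K /bump; lia.
  have ek : k = unbump j K by rewrite /K bumpK.
  case: (i =P K) => [eiK|/eqP niK].
    rewrite -eiK in ek; rewrite -ek eqxx -eiK eu.
    by rewrite -(dfaceC false true ne hi hj) -ek; exact: homotopic_refl.
  have nKi : K != i by rewrite eq_sym.
  have njK : j != K by rewrite eq_sym.
  have nk : (unbump j i == k) = false.
    by rewrite [X in _ == X]ek; apply/negbTE/unbump_neq.
  rewrite nk.
  have eK2 : bump (unbump i j) (unbump (unbump j i) k) = unbump i K.
    by move: niK; rewrite /K /bump /unbump; lia.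
  have hK2 : unbump i K < tag (end_cube p) by rewrite eu ti; exact: unbump_lt.
  have [_ eD] := drop_lower_path hp hK2.
  have eU : end_cube (drop_lower (unbump i K) p) =
      dface (unbump K i) false (dface K false z).
    by rewrite eD eu (dfaceC false false nKi).
  have := Nsquare_mix (unbump_neq ne niK njK) _ _ eU.
  rewrite tag_dface // => /(_ (unbump_lt nKi hi hK) (unbump_lt nKj hj hK)).
  move/homotopic_nsquare.
  rewrite -2!cat_rcons cats0 -2![in X in homotopic _ X -> _]cat_rcons cats0 eK2.
  rewrite -(dfaceC false true nKj hK hj) eU -ek.
  rewrite -(unbumpC ne niK njK) -ek.
  rewrite [unbump (unbump i K) _](unbumpC nji njK niK).
  suff -> : dface (unbump (unbump K i) (unbump K j)) true
      (dface (unbump K i) false (dface K false z)) =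
    dface (unbump (unbump j i) k) false (dface (unbump i j) true (end_cube p)) by [].
  have -> : unbump (unbump j i) k = unbump (unbump i j) (unbump i K).
    by rewrite ek unbumpC.
  rewrite eu (dfaceC false true) ?ti; try exact: unbump_lt; last exact: unbump_neq.
  by rewrite (unbumpC nji njK niK) (dfaceC false false nKi hK hi).
Qed.

Lemma drop_lower_homotopy (X : hda) (p q : seq (entry X)) k :
  homotopic p q -> pointed_path p -> k < tag (end_cube p) ->
  homotopic (drop_lower k p) (drop_lower k q).
Proof.
have main (p1 s t p2 : seq (entry X)) k' : nsquare (end_cube p1) s t ->
    pointed_path ((p1 ++ s) ++ p2) -> k' < tag (end_cube ((p1 ++ s) ++ p2)) ->
    homotopic (drop_lower k' ((p1 ++ s) ++ p2)) (drop_lower k' ((p1 ++ t) ++ p2)).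
  move=> sq; elim/last_ind: p2 k' => [|p2 e IH] k'.
    by rewrite !cats0; exact: drop_lower_nsquare.
  rewrite -!rcons_cat => /pointed_path_rcons [hp he]; rewrite end_cube_rcons.
  case: e he => [[[] l] x] /= /is_faceP [hl ex] hk.
    rewrite !drop_lower_down; apply/homotopic_rcons/IH => //.
    by move: hk; rewrite ex tag_dface // /bump; lia.
  rewrite !drop_lower_up; case: (l =P k') => [_|/eqP ne].
    exact/homotopic_cat/homotopic_nsquare.
  by apply/homotopic_rcons/IH => //; rewrite ex tag_dface //; exact: unbump_lt.
elim=> [{}p {}q adj|{}p|{}p {}q r h1 IH1 h2 IH2] hp hk.
- have [/(_ hp) hq epq] := adjacent_path adj; rewrite epq in hk.
  have hk' := hk; rewrite -epq in hk'.
  case: adj hp hq hk hk' => p1 [p2 [s [t [-> -> ]]]]; rewrite !catA.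
  case=> /square_nsquare sq hp hq hk hk'; first exact: main.
  exact/homotopic_sym/main.
- exact: homotopic_refl.
- have [/(_ hp) hq epq] := homotopic_path h1.
  by apply: homotopic_trans (IH1 hp hk) (IH2 hq _); rewrite -epq.
Qed.

Lemma homotopic_lower (X : hda) (p q : seq (entry X)) k x :
  pointed_path (rcons p (false, k, x)) ->
  homotopic (rcons p (false, k, x)) (rcons q (false, k, x)) -> homotopic p q.
Proof.
move=> hp h.
have hk : k < tag x by case/pointed_path_rcons: hp => _ /is_faceP [].
have := drop_lower_homotopy h hp; rewrite end_cube_rcons => /(_ k hk).
by rewrite !drop_lower_up eqxx.
Qed.

Lemma unf_face_upper (X : hda) k x (p : seq (entry X)) :
  is_face k true x (end_cube p) ->
  unf_face_set k true (homotopic p) = homotopic (rcons p (true, k, x)).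
Proof.
move=> hx; apply/funext => q; apply/propext; split=> [[p' [x' [h hx' h']]]|h].
  apply: homotopic_trans h'; have [_ e] := homotopic_path h.
  rewrite -e in hx'; move/is_faceP: hx => [_ ->]; move/is_faceP: hx' => [_ ->].
  exact: homotopic_rcons.
by exists p, x; split=> //; exact: homotopic_refl.
Qed.

Lemma unf_face_lower (X : hda) k x (p : seq (entry X)) :
  pointed_path (rcons p (false, k, x)) ->
  unf_face_set k false (homotopic (rcons p (false, k, x))) = homotopic p.
Proof.
move=> hp; apply/funext => q; apply/propext; split=> [[x' h]|h].
  have [_] := homotopic_path h; rewrite !end_cube_rcons /= => ex; subst x'.
  exact: homotopic_lower h.
by exists x; exact: homotopic_rcons.
Qed.

Lemma class_end (X : hda) (x : cube X) C p :
  is_class x C -> C p -> [/\ pointed_path p, end_cube p = x & C = homotopic p].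
Proof.
case=> q [hq <-] -> h; have [/(_ hq) hp e] := homotopic_path h.
by split=> //; exact: homotopicE.
Qed.

Lemma class_lower (X : hda) (x : cube X) C k : is_class x C -> k < tag x ->
  exists2 p, pointed_path (rcons p (false, k, x)) &
             C = homotopic (rcons p (false, k, x)).
Proof.
case=> p [hp <-] -> hk; have h := drop_lower_homotopic hp hk.
exists (drop_lower k p); last by apply: homotopicE; exact: homotopic_sym.
by have [/(_ hp)] := homotopic_path (homotopic_sym h).
Qed.

Lemma unf_face_class (X : hda) (x : cube X) C k nu : is_class x C -> k < tag x ->
  is_class (dface k nu x) (unf_face_set k nu C).
Proof.
move=> hC hk; case: nu.
- case: hC => p [hp ep] ->; have := is_face_dface true hk; rewrite -ep => hf.
  rewrite (unf_face_upper hf).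
  exists (rcons p (true, k, dface k true (end_cube p))) => //.
  by rewrite end_cube_rcons; split=> //; apply/pointed_path_rcons.
- have [p hp ->] := class_lower hC hk; rewrite unf_face_lower //.
  by exists p => //; case/pointed_path_rcons: hp => ? /is_faceP [].
Qed.

Lemma dfaceE (X : precubical) n (k : 'I_n.+1) nu (x : X n.+1) :
  dface k nu (existT X n.+1 x) = existT X n (face k nu x).
Proof. by rewrite /= valK. Qed.

Lemma unf_face_subproof (X : hda) n (k : 'I_n.+1) nu (C : unf_cell X n.+1) :
  exists x : X n, is_class (existT X n x) (unf_face_set k nu (sval C)).
Proof.
case: C => C [x hC] /=; exists (face k nu x); rewrite -dfaceE.
exact: unf_face_class.
Qed.

Definition unf_face (X : hda) n (k : 'I_n.+1) nu (C : unf_cell X n.+1) :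
  unf_cell X n := exist _ _ (unf_face_subproof k nu C).

Lemma unf_face_setC (X : hda) (x : cube X) C (k l : nat) nu mu :
  is_class x C -> k < l -> l < tag x ->
  unf_face_set k nu (unf_face_set l mu C) =
  unf_face_set l.-1 mu (unf_face_set k nu C).
Proof.
move=> hC lt_kl hl; have hk : k < tag x by lia.
have tl b : tag (dface l b x) = (tag x).-1 by rewrite tag_dface.
have tk b : tag (dface k b x) = (tag x).-1 by rewrite tag_dface.
have fl b := is_face_dface b hl; have fk b := is_face_dface b hk.
have e a b : dface k a (dface l b x) = dface l.-1 b (dface k a x).
  exact: dface_dface.
have fkl a b : is_face k a (dface k a (dface l b x)) (dface l b x).
  by apply: is_face_dface; rewrite tl; lia.
have flk a b : is_face l.-1 b (dface k a (dface l b x)) (dface k a x).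
  by rewrite e; apply: is_face_dface; rewrite tk; lia.
case: nu; case: mu.
- case: hC => p [hp ep] ->.
  rewrite (@unf_face_upper X l (dface l true x) p) ?ep //.
  rewrite (@unf_face_upper X k (dface k true x) p) ?ep //.
  rewrite (@unf_face_upper X k (dface k true (dface l true x))) ?end_cube_rcons //.
  rewrite (@unf_face_upper X l.-1 (dface k true (dface l true x)))
          ?end_cube_rcons //.
  apply: homotopicE; rewrite -!cats1 -!catA /=; apply: homotopic_square.
  by rewrite ep; exact: Square11.
- have [p hp ->] := class_lower hC hl.
  rewrite unf_face_lower //; case/pointed_path_rcons: hp => hp /is_faceP [_ ep].
  rewrite (@unf_face_upper X k (dface k true (dface l false x)) p) ?ep //.
  rewrite (@unf_face_upper X k (dface k true x)) ?end_cube_rcons //.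
  have -> : homotopic (rcons (rcons p (false, l, x)) (true, k, dface k true x)) =
      homotopic (rcons (rcons p (true, k, dface k true (dface l false x)))
                       (false, l.-1, dface k true x)).
    apply: homotopicE; rewrite -!cats1 -!catA /=; apply: homotopic_square.
    by rewrite ep; exact: Square10.
  rewrite unf_face_lower //; apply/pointed_path_rcons; rewrite end_cube_rcons.
  by split; [apply/pointed_path_rcons; rewrite /= ep | rewrite /=].
- have [p hp ->] := class_lower hC hk.
  rewrite unf_face_lower //; case/pointed_path_rcons: hp => hp /is_faceP [_ ep].
  rewrite (@unf_face_upper X l.-1 (dface k false (dface l true x)) p) ?ep //.
  rewrite (@unf_face_upper X l (dface l true x)) ?end_cube_rcons //.
  have -> : homotopic (rcons (rcons p (false, k, x)) (true, l, dface l true x)) =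
      homotopic (rcons (rcons p (true, l.-1, dface k false (dface l true x)))
                       (false, k, dface l true x)).
    apply: homotopicE; rewrite -!cats1 -!catA /=; apply: homotopic_square.
    by rewrite ep; exact: Square01.
  rewrite unf_face_lower //; apply/pointed_path_rcons; rewrite end_cube_rcons.
  by split; [apply/pointed_path_rcons; rewrite /= ep | rewrite /=].
- have [p hp ->] := class_lower hC hl.
  rewrite unf_face_lower //; case/pointed_path_rcons: hp => hp /is_faceP [_ ep].
  have hk' : k < tag (end_cube p) by rewrite ep tl; lia.
  have h := drop_lower_homotopic hp hk'.
  have [] := drop_lower_path hp hk'.
  move: (drop_lower k p) h; rewrite ep => q h hq eq.
  rewrite -(homotopicE h) unf_face_lower; last first.
    by apply/pointed_path_rcons; rewrite /= eq.
  rewrite -(homotopicE (homotopic_rcons (false, l, x) h)).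
  have -> : homotopic (rcons (rcons q (false, k, dface l false x)) (false, l, x)) =
      homotopic (rcons (rcons q (false, l.-1, dface k false x)) (false, k, x)).
    apply: homotopicE; rewrite -!cats1 -!catA /=; apply: homotopic_square.
    by rewrite eq; exact: Square00.
  have hq1 : pointed_path (rcons q (false, l.-1, dface k false x)).
    by apply/pointed_path_rcons; rewrite /= eq.
  rewrite unf_face_lower; last first.
    by apply/pointed_path_rcons; rewrite end_cube_rcons; split=> //=.
  by rewrite unf_face_lower.
Qed.

Lemma unf_face_face (X : hda) n (k l : 'I_n.+1) nu mu (C : unf_cell X n.+2) :
  k <= l ->
  unf_face k nu (unf_face (lift ord0 l) mu C) =
  unf_face l mu (unf_face (widen_ord (leqnSn _) k) nu C).
Proof.
case: C => C [x hC] le_kl; apply: eq_exist => /=.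
exact: (unf_face_setC _ _ hC (le_kl : k < l.+1) (ltn_ord l : l.+1 < n.+2)).
Qed.

Lemma unf_init_subproof (X : hda) :
  exists x : X 0, is_class (existT X 0 x) (homotopic [::]).
Proof. by exists (init X), [::]. Qed.

Definition unfolding (X : hda) : hda :=
  @Hda (Precubical (@unf_face_face X)) (exist _ _ (unf_init_subproof X)).

Definition unf_proj_fun (X : hda) n (C : unfolding X n) : X n :=
  sval (cid (svalP C)).

Lemma unf_proj_class (X : hda) n (C : unfolding X n) :
  is_class (existT X n (unf_proj_fun C)) (sval C).
Proof. exact: svalP (cid (svalP C)). Qed.

Lemma class_inj (X : hda) n (x y : X n) C :
  is_class (existT X n x) C -> is_class (existT X n y) C -> x = y.
Proof.
move=> hx [p [hp ep] eC]; have := class_end hx (p := p).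
rewrite {1}eC => /(_ (homotopic_refl p)) [_ + _]; rewrite ep.
by move=> e; rewrite (existT_inj2 e).
Qed.

Lemma unf_proj_face (X : hda) n (k : 'I_n.+1) nu (C : unfolding X n.+1) :
  unf_proj_fun (face k nu C) = face k nu (unf_proj_fun C).
Proof.
apply: (class_inj (unf_proj_class (face k nu C))); rewrite -dfaceE.
by apply: unf_face_class => //; exact: unf_proj_class.
Qed.

Lemma unf_proj_init (X : hda) : unf_proj_fun (init (unfolding X)) = init X.
Proof.
by apply: (class_inj (unf_proj_class (init (unfolding X)))); exists [::].
Qed.

Definition unf_proj (X : hda) : hda_hom (unfolding X) X :=
  @HdaHom (unfolding X) X (@unf_proj_fun X) (@unf_proj_face X) (unf_proj_init X).

(* Morphisms X -> Y of HDA up to homotopy; they compose as morphisms of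
   unfoldings. *)
Definition hdah_hom (X Y : hda) : Type := hda_hom (unfolding X) (unfolding Y).

(* The isomorphism from trees up to homotopy to trees sends phi to the unique g
   with g \o unf_proj P = unf_proj Q \o phi. *)
Definition hdph_hom (P Q : hda) (phi : hdah_hom P Q) : Prop :=
  exists g : hda_hom P Q, hdp_hom g /\
    hom_eq (hom_comp g (unf_proj P)) (hom_comp (unf_proj Q) phi).

Definition hdah_open (X Y : hda) (f : hdah_hom X Y) : Prop :=
  forall (P Q : hda) (phi : hdah_hom P Q), hdph_hom phi -> has_rlp f phi.

Definition homotopy_bisimilar (X Y : hda) : Prop :=
  exists (Z : hda) (f : hdah_hom Z X) (g : hdah_hom Z Y),
    hdah_open f /\ hdah_open g.

(* Main.v *)
From Stdlib Require Import Relation_Operators.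
From mathcomp Require Import all_boot boolp zify.
Require Import Defs.

Set Implicit Arguments.
Unset Strict Implicit.
Unset Printing Implicit Defensive.

(** A morphism out of an HDA whose cubes are all reachable by pointed cube paths
    lifts in at most one way through a projection from an unfolding, because
    the classes of the cubes along a path determine each other. For a path
    object [P] the projection has a section: lift the representing path
    [x_1, ..., x_m] to [X_1, ..., X_m] and send the iterated face [d_t x_j] to
    [d_t X_j]. Hence the projection from the unfolding of [P] is an isomorphism,
    and projections are open, which turns lifting problems over unfoldings into
    lifting problems over the original automata and back. *)

(** * Morphisms and cubes *)

Lemma is_face_fun (X : precubical) k nu (y y' x : cube X) :
  is_face k nu y x -> is_face k nu y' x -> y = y'.
Proof. by move=> /is_faceP [_ ->] /is_faceP [_ ->]. Qed.

Lemma hom_cube_face (X Y : hda) (f : hda_hom X Y) k nu (y x : cube X) :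
  is_face k nu y x -> is_face k nu (hom_cube f y) (hom_cube f x).
Proof. by case=> n {}k {}nu {}x; rewrite /hom_cube /= hom_face; exact: IsFace. Qed.

Lemma hom_cube_pt (X Y : hda) (f : hda_hom X Y) : hom_cube f (pt X) = pt Y.
Proof. by rewrite /hom_cube /= hom_init. Qed.

Lemma hom_eq_cube (X Y : hda) (f g : hda_hom X Y) :
  hom_eq f g <-> (forall x, hom_cube f x = hom_cube g x).
Proof.
split=> [h [n x]|h n x]; first by rewrite /hom_cube /= h.
exact: existT_inj2 (h (existT X n x)).
Qed.

(** Serves to build morphisms whose values are found through a choice, such as a path in a homotopy
    class or a presentation as an iterated face. Preservation of dimension types the chosen values;
    functionality of [R] makes them commute with faces. *)
Lemma hom_of_rel (X Y : hda) (R : cube X -> cube Y -> Prop) :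
  (forall x, exists y, R x y) ->
  (forall x y, R x y -> tag y = tag x) ->
  (forall x y y', R x y -> R x y' -> y = y') ->
  (forall k nu x' y' x y, R x y -> is_face k nu x' x -> is_face k nu y' y ->
     R x' y') ->
  R (pt X) (pt Y) ->
  exists f : hda_hom X Y, forall x, R x (hom_cube f x).
Proof.
move=> tot dim func fac ini.
have ex n (x : X n) : exists y : Y n, R (existT X n x) (existT Y n y).
  have [[m y] hy] := tot (existT X n x); have /= em := dim _ _ hy.
  by subst m; exists y.
pose f n x := sval (cid (ex n x)).
have fR n x : R (existT X n x) (existT Y n (f n x)) := svalP (cid (ex n x)).
have ff n (k : 'I_n.+1) nu (x : X n.+1) : f n (face k nu x) = face k nu (f n.+1 x).
  apply: (@existT_inj2 _ Y); apply: (func _ _ _ (fR _ _)).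
  exact: fac (fR _ x) (IsFace _ _ _) (IsFace _ _ _).
have fi : f 0 (init X) = init Y.
  by apply: (@existT_inj2 _ Y); apply: (func _ _ _ (fR _ _)).
by exists (HdaHom ff fi) => -[n x]; exact: fR.
Qed.

(** * Unfoldings *)

(** The dimension of [C] stays hidden in the sigma type, so that equality of cubes of the unfolding
    can be treated as homotopy of paths. *)
Definition represents (X : hda) (C : cube (unfolding X)) (p : seq (entry X)) :=
  pointed_path p /\ sval (tagged C) = homotopic p.

Lemma represents_ex (X : hda) (C : cube (unfolding X)) : exists p, represents C p.
Proof.
by case: C => n [C [x [p [hp ep] eC]]]; exists p; split.
Qed.

Lemma ex_represents (X : hda) (p : seq (entry X)) :
  pointed_path p -> exists C, represents C p.
Proof.
move=> hp.
have h : exists x : X (tag (end_cube p)),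
    is_class (existT X (tag (end_cube p)) x) (homotopic p).
  by exists (tagged (end_cube p)), p => //; split=> //; case: end_cube.
by exists (existT (unfolding X) _ (exist _ _ h : unfolding X _)).
Qed.

Lemma represents_homotopic (X : hda) (C : cube (unfolding X)) p q :
  represents C p -> represents C q -> homotopic p q.
Proof. by move=> [_ eC] [_ eC']; rewrite -eC eC'; exact: homotopic_refl. Qed.

Lemma homotopic_represents (X : hda) (C : cube (unfolding X)) p q :
  homotopic p q -> represents C p -> represents C q.
Proof.
move=> h [hp eC]; split; first by case: (homotopic_path h); auto.
by rewrite eC; exact: homotopicE.
Qed.

Lemma represents_end (X : hda) (C : cube (unfolding X)) p :
  represents C p -> hom_cube (unf_proj X) C = end_cube p.
Proof.
case: C => n C [hp /= eC].
have := class_end (unf_proj_class C) (p := p).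
by rewrite eC => /(_ (homotopic_refl p)) [_ ->].
Qed.

(** Homotopic paths have the same end cube, which makes the dimensions of [C] and [D] agree; beyond
    that a cell is its class together with a proof. *)
Lemma represents_inj (X : hda) (C D : cube (unfolding X)) p q :
  represents C p -> represents D q -> homotopic p q -> C = D.
Proof.
move=> hC hD h; have eC := represents_end hC; have eD := represents_end hD.
have [_ e] := homotopic_path h; rewrite -eC -eD in e.
have := congr1 tag e; case: C D {e eC eD} hC hD => n C [m D] [_ /= eC] [_ /= eD] enm.
subst m; congr existT; case: C D eC eD => C hC [D hD] /= eC eD.
by apply: eq_exist; rewrite eC eD; exact: homotopicE.
Qed.

Lemma sval_unf_face (X : hda) k nu (D C : cube (unfolding X)) :
  is_face k nu D C -> sval (tagged D) = unf_face_set k nu (sval (tagged C)).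
Proof. by case. Qed.

Lemma represents_upper (X : hda) (C D : cube (unfolding X)) p k :
  represents C p -> is_face k true D C ->
  represents D (rcons p (true, k, hom_cube (unf_proj X) D)).
Proof.
move=> hC hD; have := hom_cube_face (unf_proj X) hD.
rewrite (represents_end hC) => hf; split.
  by apply/pointed_path_rcons; split=> //; case: hC.
by rewrite (sval_unf_face hD) (proj2 hC); exact: unf_face_upper.
Qed.

(** By [class_lower] the class of [D] contains a path ending in a [k]-th lower step. Removing that
    step gives a path in the class of the face [C], hence one homotopic to [p]. *)
Lemma represents_lower (X : hda) (C D : cube (unfolding X)) p k :
  represents C p -> is_face k false C D ->
  represents D (rcons p (false, k, hom_cube (unf_proj X) D)).
Proof.
move=> hC hD; have := hom_cube_face (unf_proj X) hD.
rewrite (represents_end hC) => hf; split.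
  by apply/pointed_path_rcons; split=> //; case: hC.
have hk : k < tag (hom_cube (unf_proj X) D) by case/is_faceP: hf.
have [q hq eD] := class_lower (unf_proj_class (tagged D)) hk.
have := sval_unf_face hD; rewrite (proj2 hC) eD unf_face_lower // => epq.
apply: homotopicE; apply: homotopic_rcons; rewrite -epq; exact: homotopic_refl.
Qed.

(** An upper step lifts to the upper face of [C]. A lower step lifts because extending a path of the
    class [C] by it gives a class whose lower face is [C] again. *)
Lemma unf_proj_lift (X : hda) (C : cube (unfolding X)) nu k y :
  step (hom_cube (unf_proj X) C) (nu, k, y) ->
  exists2 D, step C (nu, k, D) & hom_cube (unf_proj X) D = y.
Proof.
case: nu => /= hf.
  have hk : k < tag C by case/is_faceP: hf.
  exists (dface k true C); first exact: is_face_dface.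
  exact: is_face_fun (hom_cube_face _ (is_face_dface _ hk)) hf.
have [p hC] := represents_ex C; rewrite (represents_end hC) in hf.
have hp : pointed_path (rcons p (false, k, y)).
  by apply/pointed_path_rcons; split=> //; case: hC.
have [D hD] := ex_represents hp; have eD := represents_end hD.
rewrite end_cube_rcons /= in eD; exists D => //.
have hk : k < tag D by case/is_faceP: hf => + _; rewrite -eD.
have hf' := is_face_dface false hk.
suff -> : C = dface k false D by [].
apply: (@represents_inj _ _ _ p p) => //; last exact: homotopic_refl.
by split; [case: hC|rewrite (sval_unf_face hf') (proj2 hD) unf_face_lower].
Qed.

(** * Reachable cubes and uniqueness of lifts *)

Definition reachable (X : hda) (x : cube X) : Prop :=
  exists2 p, pointed_path p & end_cube p = x.

(** A path representing [C], lifted step by step from the base point, ends in [C]: each lifted cube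
    is the class of the corresponding initial segment. *)
Lemma unf_reachable (X : hda) (C : cube (unfolding X)) : reachable C.
Proof.
have [p] := represents_ex C; elim/last_ind: p C => [|p e IH] C hC.
  exists [::] => //; apply: represents_inj (homotopic_refl [::]) => //.
case/pointed_path_rcons: (proj1 hC) => hp he.
have [D hD] := ex_represents hp; have [q hq eq] := IH D hD.
rewrite -(represents_end hD) in he; case: e hC he => [[nu k] y] hC.
case/unf_proj_lift => E hE eE.
exists (rcons q (nu, k, E)); first by apply/pointed_path_rcons; rewrite eq.
rewrite end_cube_rcons /=.
suff hE' : represents E (rcons p (nu, k, y)).
  exact: represents_inj hE' hC (homotopic_refl _).
rewrite -eE; case: nu {hC} hE => /= hE.
  exact: represents_upper hE.
exact: represents_lower hE.
Qed.

Lemma unf_proj_monic (P X : hda) (u v : hda_hom P (unfolding X)) :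
  (forall x : cube P, reachable x) ->
  hom_eq (hom_comp (unf_proj X) u) (hom_comp (unf_proj X) v) -> hom_eq u v.
Proof.
move=> reach /hom_eq_cube e; apply/hom_eq_cube => x; have [p hp <-] := reach x.
elim/last_ind: p {x} hp => [|p [[nu k] y] IH].
  by rewrite /end_cube /= !hom_cube_pt.
rewrite end_cube_rcons => /pointed_path_rcons [/IH {}IH]; case: nu => /= hf.
  have := hom_cube_face v hf; rewrite -IH.
  exact: is_face_fun (hom_cube_face u hf).
(* Along a lower step the new cube is not a face of the old one. Both images of [y] are instead
   represented by [q] extended by the same entry, as their projections agree. *)
have [q hq] := represents_ex (hom_cube u (end_cube p)).
have hu := represents_lower hq (hom_cube_face u hf).
rewrite IH in hq; have hv := represents_lower hq (hom_cube_face v hf).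
have ey : hom_cube (unf_proj X) (hom_cube u y) =
          hom_cube (unf_proj X) (hom_cube v y) by exact: e.
by apply: (represents_inj hu hv); rewrite ey; exact: homotopic_refl.
Qed.

(** * Functoriality of the unfolding *)

Definition map_entry (X Y : hda) (f : hda_hom X Y) (e : entry X) : entry Y :=
  (e.1, hom_cube f e.2).

Lemma step_map (X Y : hda) (f : hda_hom X Y) x (e : entry X) :
  step x e -> step (hom_cube f x) (map_entry f e).
Proof. by case: e => [[[] k] y] /=; exact: hom_cube_face. Qed.

Lemma end_cube_map (X Y : hda) (f : hda_hom X Y) (p : seq (entry X)) :
  end_cube (map (map_entry f) p) = hom_cube f (end_cube p).
Proof.
elim/last_ind: p => [|p e _]; first by rewrite /end_cube /= hom_cube_pt.
by rewrite map_rcons !end_cube_rcons.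
Qed.

Lemma pointed_path_map (X Y : hda) (f : hda_hom X Y) (p : seq (entry X)) :
  pointed_path p -> pointed_path (map (map_entry f) p).
Proof.
elim/last_ind: p => [//|p e IH] /pointed_path_rcons [/IH hp he].
by rewrite map_rcons; apply/pointed_path_rcons; rewrite end_cube_map; split=> //;
  exact: step_map.
Qed.

Lemma square_map (X Y : hda) (f : hda_hom X Y) u (s t : seq (entry X)) :
  square u s t ->
  square (hom_cube f u) (map (map_entry f) s) (map (map_entry f) t).
Proof.
by case=> * /=; [apply: Square00|apply: Square11|apply: Square01|apply: Square10]
  => //; apply: hom_cube_face.
Qed.

Lemma homotopic_map (X Y : hda) (f : hda_hom X Y) (p q : seq (entry X)) :
  homotopic p q -> homotopic (map (map_entry f) p) (map (map_entry f) q).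
Proof.
elim=> [{}p {}q|{}p|{}p {}q r _ h1 _ h2].
- case=> p1 [p2 [s [t [-> -> h]]]]; rewrite !map_cat; apply: rt_step.
  exists (map (map_entry f) p1), (map (map_entry f) p2).
  exists (map (map_entry f) s), (map (map_entry f) t); split=> //.
  by rewrite end_cube_map; case: h => /(square_map f); auto.
- exact: homotopic_refl.
- exact: homotopic_trans h1 h2.
Qed.

Lemma unfolding_map (X Y : hda) (f : hda_hom X Y) :
  exists g : hda_hom (unfolding X) (unfolding Y),
    hom_eq (hom_comp (unf_proj Y) g) (hom_comp f (unf_proj X)).
Proof.
(* The class of a path goes to the class of its image; [homotopic_map] makes this independent of the
   path. *)
pose R C D := exists2 p, represents C p & represents D (map (map_entry f) p).
have Rproj C D : R C D ->
    hom_cube (unf_proj Y) D = hom_cube f (hom_cube (unf_proj X) C).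
  case=> p /represents_end -> /represents_end ->; exact: end_cube_map.
have Rfun C D D' : R C D -> R C D' -> D = D'.
  move=> [p hC hD] [q hC' hD']; apply: represents_inj hD hD' _.
  exact/homotopic_map/represents_homotopic/hC'.
have Rface k nu C' D' C D :
    R C D -> is_face k nu C' C -> is_face k nu D' D -> R C' D'.
  move=> RCD fC fD; have eD := Rproj _ _ RCD; case: RCD => p hC hD.
  have fC' := hom_cube_face f (hom_cube_face (unf_proj X) fC).
  case: nu fC fD fC' => fC fD fC'.
    have hC' := represents_upper hC fC; have hD' := represents_upper hD fD.
    have := hom_cube_face (unf_proj Y) fD; rewrite eD => fD'.
    rewrite -(is_face_fun fC' fD') in hD'.
    by exists (rcons p (true, k, hom_cube (unf_proj X) C')); rewrite // map_rcons.
  (* For a lower face, start from a path [q] of the face: extended by the lower step it lies in the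
     class of [C], and after mapping by [f] taking the lower face removes that step again. *)
  have [q hC'] := represents_ex C'; have hqC := represents_lower hC' fC.
  exists q => //; split; first exact: pointed_path_map (proj1 hC').
  have := homotopic_map f (represents_homotopic hC hqC).
  move=> /homotopic_represents /(_ hD) []; rewrite map_rcons => hq eD'.
  by rewrite (sval_unf_face fD) eD'; exact: unf_face_lower.
have [|||g hg] := hom_of_rel _ _ Rfun Rface.
- move=> C; have [p hC] := represents_ex C.
  have [D hD] := ex_represents (pointed_path_map f (proj1 hC)).
  by exists D, p.
- by move=> C D /Rproj /(congr1 tag).
- by exists [::].
- by exists g; apply/hom_eq_cube => C; exact: (Rproj _ _ (hg C)).
Qed.

(** * Iterated faces *)

(** One step of an insertion sort by the precubical identity: moving a face of index [k] inwards
    past one of index [l <= k] raises its index to [k.+1]. *)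
Fixpoint insert_face (k : nat) (nu : bool) (t : seq (nat * bool)) :=
  if t is (l, mu) :: t' then
    if k < l then (k, nu) :: t else (l, mu) :: insert_face k.+1 nu t'
  else [:: (k, nu)].

Lemma insert_face_path m k nu t :
  m < k -> path ltn m (unzip1 t) -> path ltn m (unzip1 (insert_face k nu t)).
Proof.
elim: t m k => [|[l mu] t IH] m k lt_mk /=; first by rewrite lt_mk.
case/andP=> lt_ml ht; case: ifP => [lt_kl|ge_kl] /=; first by rewrite lt_mk lt_kl.
by rewrite lt_ml IH //; lia.
Qed.

Lemma insert_face_sorted k nu t :
  sorted ltn (unzip1 t) -> sorted ltn (unzip1 (insert_face k nu t)).
Proof.
case: t => [//|[l mu] t] /= ht; case: ifP => [lt_kl|ge_kl] /=; first by rewrite lt_kl.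
by apply: insert_face_path => //; lia.
Qed.

Lemma is_face_swap (X : precubical) k l nu mu (y z x : cube X) :
  l <= k -> is_face k nu y z -> is_face l mu z x ->
  exists2 w, is_face l mu y w & is_face k.+1 nu w x.
Proof.
move=> le_lk /is_faceP [hk ->] /is_faceP [hl ez]; rewrite ez in hk *.
rewrite tag_dface // in hk.
have hk1 : k.+1 < tag x by lia.
exists (dface k.+1 nu x); last exact: is_face_dface.
apply/is_faceP; split; first by rewrite tag_dface //; lia.
by rewrite (@dface_dface X l k.+1).
Qed.

Lemma insert_face_rec (X : precubical) k nu t (y z x : cube X) :
  is_face k nu y z -> iter_face_rec t z x ->
  iter_face_rec (insert_face k nu t) y x.
Proof.
elim: t k y z => [|[l mu] t IH] k y z hf /=; first by move=> <-; exists z.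
case=> w hw ht; case: ifP => [_|ge_kl]; first by exists z => //; exists w.
have le_lk : l <= k by lia.
by have [v hv hv'] := is_face_swap le_lk hf hw; exists v => //; exact: IH ht.
Qed.

Lemma iter_face_sort (X : precubical) t (y x : cube X) :
  iter_face_rec t y x -> exists t', iter_face t' y x.
Proof.
elim: t y => [|[k nu] t IH] y /=; first by move=> ->; exists [::].
case=> z hz /IH [t' [st ht]]; exists (insert_face k nu t').
by split; [exact: insert_face_sorted | exact: insert_face_rec ht].
Qed.

Lemma iter_face_rec_rcons (X : precubical) t k nu (y z x : cube X) :
  iter_face_rec t y z -> is_face k nu z x ->
  iter_face_rec (rcons t (k, nu)) y x.
Proof.
move=> + hz; elim: t y => [|[l mu] t IH] y /=; first by move=> ->; exists x.
by case=> w hw /IH h; exists w.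
Qed.

Lemma iter_face_rec_fun (X : precubical) t (y y' x : cube X) :
  iter_face_rec t y x -> iter_face_rec t y' x -> y = y'.
Proof.
elim: t y y' => [|[k nu] t IH] y y' /=; first by move=> -> ->.
case=> z hz /IH {}IH [z' hz' /IH e]; subst z'; exact: is_face_fun hz hz'.
Qed.

Lemma iter_face_hom (X Y : hda) (f : hda_hom X Y) t (y x : cube X) :
  iter_face t y x -> iter_face t (hom_cube f y) (hom_cube f x).
Proof.
case=> st h; split=> // {st}; elim: t y h => [|[k nu] t IH] y /=; first by move=> ->.
by case=> z hz /IH; exists (hom_cube f z) => //; exact: hom_cube_face.
Qed.

(** Morphisms preserve dimension, so each face taken of the image of [x] can already be taken of
    [x]. *)
Lemma iter_face_lift (X Y : hda) (f : hda_hom X Y) t y (x : cube X) :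
  iter_face t y (hom_cube f x) -> exists2 y', iter_face t y' x & hom_cube f y' = y.
Proof.
case=> st h; suff [y' h' <-] : exists2 y', iter_face_rec t y' x & hom_cube f y' = y.
  by exists y'.
elim: t y h {st} => [|[k nu] t IH] y /=; first by move=> ->; exists x.
case=> z hz /IH [z' hz' ez]; subst z.
have hk : k < tag z' by case/is_faceP: hz.
exists (dface k nu z'); first by exists z' => //; exact: is_face_dface.
exact: is_face_fun (hom_cube_face _ (is_face_dface _ hk)) hz.
Qed.

(** * Path objects *)

Lemma cube_path_cons (X : precubical) (x y : cube X) s :
  cube_path [:: x, y & s] <->
  (exists k, is_face k false x y \/ is_face k true y x) /\ cube_path (y :: s).
Proof.
split=> [[_ h]|[h0 [_ h]]].
  by split; [exact: (h 0)|split=> // j; exact: (h j.+1)].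
by split=> // -[|j] x' y'; [move=> [<-] [<-]|exact: h].
Qed.

Lemma cube_path_lift (X : hda) (C : cube (unfolding X)) s :
  cube_path (hom_cube (unf_proj X) C :: s) ->
  exists2 S, cube_path (C :: S) & map (hom_cube (unf_proj X)) S = s.
Proof.
elim: s C => [|y s IH] C.
  by exists [::] => //; split=> // -[|j].
case/cube_path_cons=> -[k hk] hs.
have [D hD eD] : exists2 D, is_face k false C D \/ is_face k true D C &
    hom_cube (unf_proj X) D = y.
  case: hk => hk; [have := @unf_proj_lift X C false k y hk
                  |have := @unf_proj_lift X C true k y hk];
    by case=> D hD eD; exists D; auto.
subst y; have [S hS <-] := IH D hs; exists (D :: S) => //.
by apply/cube_path_cons; split=> //; exists k.
Qed.

Lemma hdp_section (P : hda) : hdp_object P ->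
  exists u : hda_hom P (unfolding P), hom_eq (hom_comp (unf_proj P) u) (hom_id P).
Proof.
case=> s [[hpath _ gen uniq_face conv] hpt].
have [S pathS [eS ptS]] : exists2 S, cube_path S &
    map (hom_cube (unf_proj P)) S = s /\ onth S 0 = Some (pt (unfolding P)).
  case: s hpath hpt {gen uniq_face conv} => [//|x s] hpath [ex].
  rewrite ex -(hom_cube_pt (unf_proj P)) in hpath *.
  by have [S hS <-] := cube_path_lift hpath; exists (pt (unfolding P) :: S).
have onthS j D : onth S j = Some D -> onth s j = Some (hom_cube (unf_proj P) D).
  by move=> h; rewrite -eS onth_map h.
have onthS' j x : onth s j = Some x ->
    exists2 D, onth S j = Some D & hom_cube (unf_proj P) D = x.
  by rewrite -eS onth_map; case: onth => //= D [<-]; exists D.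
pose Sface j C := exists D t, onth S j = Some D /\ iter_face t C D.
pose sface j y := exists x t, onth s j = Some x /\ iter_face t y x.
have SfaceP j C : Sface j C -> sface j (hom_cube (unf_proj P) C).
  move=> [D [t [hD ht]]]; exists (hom_cube (unf_proj P) D), t.
  by split; [exact: onthS | exact: iter_face_hom].
have Sface_lift j y : sface j y ->
    exists2 C, Sface j C & hom_cube (unf_proj P) C = y.
  move=> [x [t [/onthS' [D hD <-] /iter_face_lift [C hC <-]]]].
  by exists C => //; exists D, t.
(* Inside a single cube of the path the increasing index sequence of a face is unique, so equal
   projections force equal sequences and hence equal lifts. *)
have Sface_inj j C C' : Sface j C -> Sface j C' ->
    hom_cube (unf_proj P) C = hom_cube (unf_proj P) C' -> C = C'.
  move=> [D [t [hD ht]]] [D' [t' [+ ht']]] e; rewrite hD => -[eD]; subst D'.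
  have := iter_face_hom (unf_proj P) ht'; rewrite -e => h'.
  have := uniq_face _ _ _ _ _ (onthS _ _ hD) (iter_face_hom _ ht) h'.
  by move=> ett'; subst t'; case: ht ht' => _ ht [_]; exact: iter_face_rec_fun.
(* A face of [x_j] and [x_(j+1)] has the same lift along both: one of the two
   cubes is a face of the other, and increasing index sequences are unique. *)
have Sface_next j C : Sface j C -> sface j.+1 (hom_cube (unf_proj P) C) ->
    Sface j.+1 C.
  move=> SC /Sface_lift [C' SC' e]; case: (SC) (SC') => D [t [hD ht]].
  case=> D' [t' [hD' ht']].
  have [k [hk|hk]] := proj2 pathS _ _ _ hD hD'.
    have [t1 ht1] := iter_face_sort (iter_face_rec_rcons (proj2 ht) hk).
    by exists D', t1.
  have [t1 ht1] := iter_face_sort (iter_face_rec_rcons (proj2 ht') hk).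
  suff <- : C' = C by [].
  by apply: (Sface_inj j) => //; exists D, t1.
(* The lift does not depend on the cube of the path it is computed from: by the gluing clause [conv]
   a common face of two members is a face of all members between them, and [Sface_next] carries the
   lift from one to the next. *)
have Sface_fun i j C C' : Sface i C -> Sface j C' ->
    hom_cube (unf_proj P) C = hom_cube (unf_proj P) C' -> C = C'.
  wlog le_ij : i j C C' / i <= j.
    move=> main hC hC' e; case/orP: (leq_total i j) => le_ij.
      exact: main le_ij hC hC' e.
    by apply/esym; exact: main le_ij hC' hC (esym e).
  move=> hC hC' e; apply: (Sface_inj j) => //.
  have si := SfaceP _ _ hC; have := SfaceP _ _ hC'; rewrite -e => sj.
  have sl l : i <= l <= j -> sface l (hom_cube (unf_proj P) C).
    move=> hl; have [xi [ti [hxi hti]]] := si; have [xj [tj [hxj htj]]] := sj.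
    case hxl : (onth s l) => [xl|].
      have [] := conv i l j xi xl xj (hom_cube (unf_proj P) C) => //.
      - by exists ti.
      - by exists tj.
      - by move=> t ht; exists xl, t.
    have hj : j < size s by rewrite -onthTE hxj.
    have : l < size s by lia.
    by rewrite -onthTE hxl.
  have {hC'} : forall d, i + d <= j -> Sface (i + d) C.
    elim=> [|d IH] hd; first by rewrite addn0.
    by rewrite addnS; apply: Sface_next; [apply: IH|apply: sl]; lia.
  by move/(_ (j - i)); rewrite subnKC //; exact.
(* The section is the inverse of the projection restricted to the iterated faces of the lifted
   path. *)
pose R y C := (exists j, Sface j C) /\ hom_cube (unf_proj P) C = y.
have Rfun y C C' : R y C -> R y C' -> C = C'.
  by move=> [[i hC] <-] [[j hC'] e]; apply: Sface_fun hC hC' (esym e).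
have Rface k nu y' C' y C :
    R y C -> is_face k nu y' y -> is_face k nu C' C -> R y' C'.
  move=> [[j [D [t [hD [_ ht]]]]] <-] hy hC; split.
    have [|t' ht'] := @iter_face_sort _ ((k, nu) :: t) C' D; first by exists C.
    by exists j, D, t'.
  exact: is_face_fun (hom_cube_face _ hC) hy.
have [|||u hu] := hom_of_rel _ _ Rfun Rface.
- move=> y; have [j [x [t [hx ht]]]] := gen y.
  have [|C hC e] := Sface_lift j y; first by exists x, t.
  by exists C; split=> //; exists j.
- by move=> y C [_ <-].
- by split; [exists 0, (pt (unfolding P)), [::]|exact: hom_cube_pt].
- by exists u; apply/hom_eq_cube => -[n y]; exact: (proj2 (hu (existT P n y))).
Qed.

(** Both sides have the same composite with the projection, and lifts out of an unfolding are
    unique. *)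
Lemma section_retraction (P : hda) (u : hda_hom P (unfolding P)) :
  hom_eq (hom_comp (unf_proj P) u) (hom_id P) ->
  hom_eq (hom_comp u (unf_proj P)) (hom_id (unfolding P)).
Proof.
move=> hu; apply: unf_proj_monic; first exact: unf_reachable.
by move=> n x; exact: hu.
Qed.

(** A path representing the image of [x] under the section ends in [x]. *)
Lemma hdp_reachable (P : hda) : hdp_object P -> forall x : cube P, reachable x.
Proof.
move=> /hdp_section [u /hom_eq_cube hu] x.
have [p hp] := represents_ex (hom_cube u x).
exists p; first by case: hp.
by rewrite -(represents_end hp); have := hu x; case: x {hp}.
Qed.

Lemma hdp_hom_objects (P Q : hda) (g : hda_hom P Q) :
  hdp_hom g -> hdp_object P /\ hdp_object Q.
Proof.
elim=> [//|P' Q' f [s [t [hs ht]]]|P' Q' T h f _ [hP _] _ [_ hT]] //.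
by split; [exists s|exists (map (hom_cube f) s ++ t)].
Qed.

(** * Open maps *)

(** The filler is the section of [Q] followed by the unfolding of [q]. The triangle over [X]
    commutes by construction, the other one by uniqueness of lifts out of [P]. *)
Lemma unf_proj_open (X : hda) : hda_open (unf_proj X).
Proof.
move=> P Q g /hdp_hom_objects [hP hQ] p q e.
have [u hu] := hdp_section hQ; have [q' hq'] := unfolding_map q.
have hr : hom_eq (hom_comp (unf_proj X) (hom_comp q' u)) q.
  by move=> n x; have /= -> := hq' n (u n x); have /= -> := hu n x.
exists (hom_comp q' u); split=> //.
apply: unf_proj_monic; first exact: hdp_reachable.
by move=> n x; have /= -> := hr n (g n x); have /= -> := e n x.
Qed.

Lemma hda_open_comp (X Y Z : hda) (g : hda_hom Y Z) (f : hda_hom X Y) :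
  hda_open f -> hda_open g -> hda_open (hom_comp g f).
Proof.
move=> of_ og P Q h hh p q e.
have [r [hr1 hr2]] := og _ _ _ hh (hom_comp f p) q e.
have [r' [hr1' hr2']] := of_ _ _ _ hh p r (fun n x => esym (hr1 n x)).
exists r'; split=> // n x /=; have /= -> := hr2' n x; exact: hr2.
Qed.

(** Composing the square with the projections of [P] and [Q] gives a lifting problem against the
    unfolding of [g]; the section of [Q] brings its solution back. *)
Lemma hdah_open_hda_open (X Y : hda) (f : hdah_hom X Y) :
  hdah_open f -> hda_open f.
Proof.
move=> of_ P Q g hg p q e; have [hP hQ] := hdp_hom_objects hg.
have [uP huP] := hdp_section hP; have [uQ huQ] := hdp_section hQ.
have [g' hg'] := unfolding_map g.
have hphi : hdph_hom g' by exists g; split=> // n x; have /= -> := hg' n x.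
have [|r [hr1 hr2]] :=
    of_ _ _ _ hphi (hom_comp p (unf_proj P)) (hom_comp q (unf_proj Q)).
  by move=> n x /=; have /= -> := hg' n x; exact: e.
(* Naturality of the sections: both sides project to [g]. *)
have eu : hom_eq (hom_comp uQ g) (hom_comp g' uP).
  apply: unf_proj_monic; first exact: hdp_reachable.
  move=> n x /=; have /= -> := huQ n (g n x); have /= -> := hg' n (uP n x).
  by have /= -> := huP n x.
exists (hom_comp r uQ); split=> n x /=.
  by have /= -> := eu n x; have /= -> := hr1 n (uP n x); have /= -> := huP n x.
by have /= -> := hr2 n (uQ n x); have /= -> := huQ n x.
Qed.

(** Sections and projections turn the square into one over [f], with a filler [r]. The unfolding of
    [r] fills the original square, since both triangles commute after projection and unfoldings are
    reachable. *)
Lemma hda_open_unfolding (X Y : hda) (f : hda_hom X Y) (f' : hdah_hom X Y) :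
  hom_eq (hom_comp (unf_proj Y) f') (hom_comp f (unf_proj X)) ->
  hda_open f -> hdah_open f'.
Proof.
move=> hf of_ P Q phi [g [hg hphi]] p q e; have [hP hQ] := hdp_hom_objects hg.
have [uP huP] := hdp_section hP; have [uQ huQ] := hdp_section hQ.
have eu : hom_eq (hom_comp uQ g) (hom_comp phi uP).
  apply: unf_proj_monic; first exact: hdp_reachable.
  move=> n x /=; have /= -> := huQ n (g n x); have /= <- := hphi n (uP n x).
  by have /= -> := huP n x.
have uPK := section_retraction huP; have uQK := section_retraction huQ.
have [|r [hr1 hr2]] := of_ _ _ _ hg (hom_comp (unf_proj X) (hom_comp p uP))
    (hom_comp (unf_proj Y) (hom_comp q uQ)).
  move=> n x /=; have /= -> := eu n x; have /= <- := hf n (p n (uP n x)).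
  by have /= -> := e n (uP n x).
have [r' hr'] := unfolding_map r; exists r'.
split; apply: unf_proj_monic; try exact: unf_reachable; move=> n x /=.
  have /= -> := hr' n (phi n x); have /= <- := hphi n x.
  by have /= -> := hr1 n (unf_proj P n x); have /= -> := uPK n x.
have /= -> := hf n (r' n x); have /= -> := hr' n x.
by have /= -> := hr2 n (unf_proj Q n x); have /= -> := uQK n x.
Qed.

Theorem theorem5p7 (X Y : hda) : homotopy_bisimilar X Y <-> bisimilar X Y.
Proof.
split=> [] [Z [f [g [of_ og]]]].
  (* The legs are morphisms of unfoldings, so the apex becomes the unfolding of [Z], and the open
     projections lead down to [X] and [Y]. *)
  exists (unfolding Z), (hom_comp (unf_proj X) f), (hom_comp (unf_proj Y) g).
  by split; apply: hda_open_comp (@unf_proj_open _); exact: hdah_open_hda_open.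
(* Conversely, unfolding the legs keeps the apex [Z], as morphisms up to homotopy are by definition
   morphisms of unfoldings. *)
have [f' hf] := unfolding_map f; have [g' hg] := unfolding_map g.
exists Z, f', g'; split; first exact: hda_open_unfolding hf _.
exact: hda_open_unfolding hg _.
Qed.
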